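(* Consider the compromise game with compromise payoff $B\in(0,1/2]$ described in the context. Let $\tilde X$ be the set of indifferent types, i.e. the set of all $\tilde x(\sigma)$ with $\sigma\in\Sigma$ a QRE satisfying translation invariance (S1), where $\tilde x(\sigma)$ is the type with $\Delta\bar u_{\tilde x(\sigma)}(\sigma)=0$. Then $\tilde X=(0,B)$, and a strategy $\sigma\in\Sigma$ is a QRE satisfying translation invariance (S1) if and only if: (i) $\sigma$ is continuous and strictly increasing; (ii) $\sigma(x)\in(0,1)$ for all $x\in\mathcal X$; (iii) there exists a unique indifferent type $\tilde x\in\tilde X=(0,B)$ such that $\sigma(\tilde x)=\frac12$ and $\tilde x=G_\sigma^{-1}(B)$.
   Context: Compromise game. Two players simultaneously choose to fight (action 1) or flee (action 0). Each has a private strength (type) $x$ uniform on $\mathcal X=[0,1]$, i.i.d. across players. If at least one player fights, the stronger player receives 1 and the weaker 0; if both flee, each receives $B$. $\Sigma$ is the set of Lebesgue measurable $\sigma:[0,1]\to[0,1]$, $\sigma(x)$ being the probability that type $x$ fights; both players use the same $\sigma$. Expected payoffs are $\bar u^1_x(\sigma)=x$ and $\bar u^0_x(\sigma)=\int_0^x\sigma(x')\,dx'+B\int_0^1(1-\sigma(x'))\,dx'$; write $\bar u_x(\sigma)=(\bar u^1_x(\sigma),\bar u^0_x(\sigma))$, $\Delta\bar u_x(\sigma)=\bar u^1_x(\sigma)-\bar u^0_x(\sigma)$. $G_\sigma(x)=\int_0^x(1-\sigma(x'))\,dx'\big/\int_0^1(1-\sigma(x'))\,dx'$ is the c.d.f.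 of types conditional on fleeing, and $G_\sigma^{-1}$ is its inverse; thus $\Delta\bar u_x(\sigma)=(G_\sigma(x)-B)\int_0^1(1-\sigma(x'))\,dx'$. QRE with translation invariance. $\sigma\in\Sigma$ is a QRE satisfying (S1) if there exists $Q:\mathbb R^2\to[0,1]$ with $\sigma(x)=Q(\bar u_x(\sigma))$ for all $x\in[0,1]$ satisfying, with $v=(v^1,v^0)$: (R1) $Q(v)\in(0,1)$ for all $v$; (R2) $Q$ is continuous; (R3) $\frac{\partial Q(v)}{\partial v^1}>0>\frac{\partial Q(v)}{\partial v^0}$ for all $v\in\mathbb R^2$; (R4) $v^1>v^0\iff Q(v)>1-Q(v)$; (S1) $Q(v+\gamma(1,1))=Q(v)$ for all $v\in\mathbb R^2,\gamma\in\mathbb R$.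
   Formalization: With (R3) as derivatives, ''if'' fails for strategies with a kink, so (i)-(iii) are supplemented by: σ differentiable on [0,1] with positive derivative; the equivalence with (i)-(iii) alone is shown with (R3) read as Q strictly increasing in v^1, strictly decreasing in v^0. *)

(* Defs.v *)
From HB Require Import structures.
From mathcomp Require Export all_boot all_order all_algebra.
From mathcomp Require Export all_classical all_reals all_analysis.

Set Implicit Arguments.
Unset Strict Implicit.
Unset Printing Implicit Defensive.

Import Order.TTheory GRing.Theory Num.Theory.
Import numFieldNormedType.Exports.

Local Open Scope classical_set_scope.
Local Open Scope ring_scope.

(* The real line with its Lebesgue (not merely Borel) sigma-algebra, which is
   the Caratheodory sigma-algebra of the Lebesgue outer measure. *)
Definition lebesgueR (R : realType) :=
  caratheodory_type ((wlength (idfun : R -> R))^*)%mu.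

(* Strategies are total functions on R, of which only the values on [0, 1]
   matter. *)
Definition strategy (R : realType) (sigma : R -> R) : Prop :=
  measurable_fun (`[0, 1] : set (lebesgueR R)) (sigma : lebesgueR R -> R) /\
  {in `[0, 1], forall x, 0 <= sigma x <= 1}.

Definition integral01 (R : realType) (f : R -> R) (x : R) : R :=
  \int[completed_lebesgue_measure]_(t in `[0, x]) f t.

Definition payoff_fight (R : realType) (x : R) : R := x.

Definition payoff_flee (R : realType) (B : R) (sigma : R -> R) (x : R) : R :=
  integral01 sigma x + B * integral01 (fun t => 1 - sigma t) 1.

Definition payoffs (R : realType) (B : R) (sigma : R -> R) (x : R) : R * R :=
  (payoff_fight x, payoff_flee B sigma x).

Definition payoff_gap (R : realType) (B : R) (sigma : R -> R) (x : R) : R :=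
  payoff_fight x - payoff_flee B sigma x.

Definition flee_cdf (R : realType) (sigma : R -> R) (x : R) : R :=
  integral01 (fun t => 1 - sigma t) x / integral01 (fun t => 1 - sigma t) 1.

(* Inverse of [flee_cdf sigma] seen as a function on [0, 1]; it is a genuine
   inverse as soon as sigma < 1, where [flee_cdf sigma] is a bijection of
   [0, 1]. The default value 0 is only used outside the range. *)
Definition flee_quantile (R : realType) (sigma : R -> R) : R -> R :=
  'pinv_(fun=> 0) `[0, 1] (flee_cdf sigma).

(* Quantal response functions Q map v = (v.1, v.2) = (payoff of fighting,
   payoff of fleeing) to the probability of fighting; that Q has values in
   [0, 1] is subsumed by [interior_response]. *)
Definition interior_response (R : realType) (Q : R * R -> R) : Prop :=
  forall v, 0 < Q v < 1.

(* Responsiveness comes in two strengths. [diff_responsive] asks for partial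
   derivatives that exist everywhere and are nonzero with the right sign.
   [mono_responsive] is the ordinal form: Q strictly increases in its own
   payoff and strictly decreases in the other one. The ordinal form is the one
   matching strategies that are only continuous and strictly increasing: under
   [diff_responsive] a QRE is moreover differentiable (see
   [positive_derivative]). *)
Definition diff_responsive (R : realType) (Q : R * R -> R) : Prop :=
  forall v : R * R,
    [/\ derivable (fun t : R => Q (t, v.2)) v.1 1,
        derivable (fun t : R => Q (v.1, t)) v.2 1,
        0 < derive1 (fun t : R => Q (t, v.2)) v.1
      & derive1 (fun t : R => Q (v.1, t)) v.2 < 0].

Definition mono_responsive (R : realType) (Q : R * R -> R) : Prop :=
  forall a b w : R, a < b -> Q (a, w) < Q (b, w) /\ Q (w, b) < Q (w, a).

Definition payoff_monotone (R : realType) (Q : R * R -> R) : Prop :=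
  forall v : R * R, (v.2 < v.1) <-> (1 - Q v < Q v).

Definition translation_invariant (R : realType) (Q : R * R -> R) : Prop :=
  forall (v : R * R) (c : R), Q (v.1 + c, v.2 + c) = Q v.

Definition qre (R : realType) (responsive : (R * R -> R) -> Prop)
    (B : R) (sigma : R -> R) : Prop :=
  exists Q : R * R -> R,
    {in `[0, 1], forall x, sigma x = Q (payoffs B sigma x)} /\
    [/\ interior_response Q, continuous Q, responsive Q,
        payoff_monotone Q & translation_invariant Q].

Definition indifferent (R : realType) (B : R) (sigma : R -> R) (x : R) : Prop :=
  x \in `[0, 1] /\ payoff_gap B sigma x = 0.

Definition indifferent_types (R : realType)
    (responsive : (R * R -> R) -> Prop) (B : R) : set R :=
  [set x | exists sigma : R -> R,
     [/\ strategy sigma, qre responsive B sigma & indifferent B sigma x]].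

Definition continuous_increasing (R : realType) (sigma : R -> R) : Prop :=
  {within `[0, 1], continuous sigma} /\
  {in `[0, 1] &, {homo sigma : x y / x < y}}.

Definition interior_strategy (R : realType) (sigma : R -> R) : Prop :=
  {in `[0, 1], forall x, 0 < sigma x < 1}.

Definition indifference_condition (R : realType) (B : R) (sigma : R -> R) :
    Prop :=
  exists x : R, unique (indifferent B sigma) x /\
    [/\ x \in `]0, B[, sigma x = 2^-1 & x = flee_quantile sigma B].

(* sigma is differentiable on [0, 1] with positive derivative, one-sided at the
   endpoints. *)
Definition positive_derivative (R : realType) (sigma : R -> R) : Prop :=
  forall x : R, x \in `[0, 1] ->
    exists2 l : R, 0 < l &
      (sigma y - sigma x) / (y - x) @[y --> within `[0, 1] x^'] --> l.

(* Main.v *)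
Require Import Defs.
From mathcomp Require Import ring lra.

(* Under translation invariance a QRE has the form sigma = q o gap, where
   q(t) = Q(t, 0) is increasing with q(0) = 1/2 and gap(x), the payoff gap, is
   an antiderivative of 1 - sigma > 0. Hence sigma is continuous and increasing,
   gap has a unique zero x, and sigma(x) = 1/2; since 1 - sigma is decreasing,
   more than a fraction x of its mass lies in [0, x], so x < B.

   Conversely, extend sigma and gap to increasing functions on the real line,
   gap affinely (hence onto) and sigma by rational tails with values in (0, 1);
   then q = sigma o gap^-1 is a response function rationalizing sigma.

   Finally, z in (0, B) is the indifferent type of a suitable mixture of the
   constant strategy 1/2 and of a steep logistic strategy centered at z. *)

Set Implicit Arguments.
Unset Strict Implicit.
Unset Printing Implicit Defensive.

Import Order.TTheory GRing.Theory Num.Theory.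
Import numFieldNormedType.Exports.
Local Open Scope classical_set_scope.
Local Open Scope ring_scope.

(** * Integrals of strategies *)

Section flee_integral.
Context {R : realType}.
Implicit Types (f sigma : R -> R) (A : set R) (a b x y m M : R).

Local Notation mu := (@completed_lebesgue_measure R).
Local Notation LR := (lebesgueR R).

(** The numerator of [flee_cdf]; up to a constant it is the payoff gap. *)
Definition flee_mass sigma x := integral01 (fun t => 1 - sigma t) x.

Lemma measurable_lebesgueR A : measurable A -> measurable (A : set LR).
Proof. by move=> mA; exact: sub_caratheodory. Qed.

Lemma measurable_fun_lebesgueR A f :
  measurable A -> measurable_fun A f ->
  measurable_fun (A : set LR) (f : LR -> R).
Proof.
by move=> mA mf _ Y mY; apply: measurable_lebesgueR; exact: mf.
Qed.

Lemma measurable_itv_lebesgueR (i : interval R) :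
  measurable ([set` i] : set LR).
Proof. apply: measurable_lebesgueR; exact: measurable_itv. Qed.

Lemma completed_lebesgue_measure_itvoc a b : a <= b ->
  mu `]a, b] = (b - a)%:E.
Proof.
(* Both measures restrict the same outer measure, hence agree by conversion. *)
move=> ab; have -> : mu `]a, b] = lebesgue_measure (`]a, b] : set R) by [].
rewrite lebesgue_measure_itv/= lte_fin; case: ltP => // ba.
by have -> : b - a = 0 by apply/eqP; rewrite subr_eq0 eq_le ab ba.
Qed.

Lemma completed_lebesgue_measure_itvcc a b : a <= b ->
  mu `[a, b] = (b - a)%:E.
Proof.
move=> ab; have -> : mu `[a, b] = lebesgue_measure (`[a, b] : set R) by [].
rewrite lebesgue_measure_itv/= lte_fin; case: ltP => // ba.
by have -> : b - a = 0 by apply/eqP; rewrite subr_eq0 eq_le ab ba.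
Qed.

Lemma bounded_integrable (D : set LR) (f : LR -> R) r m M :
  measurable D -> mu D = r%:E -> measurable_fun D f ->
  (forall x, D x -> m <= f x <= M) -> mu.-integrable D (EFin \o f).
Proof.
move=> mD muD mf fmM.
apply: measurable_bounded_integrable => //; first by rewrite [ltLHS]muD ltry.
exists (`|m| + `|M|); split; first exact: num_real.
move=> y ltmMy x Dx /=; apply: le_trans (ltW ltmMy).
have /andP[mfx fxM] := fmM _ Dx; rewrite ler_norml; apply/andP; split.
- by have := ler_norm (- m); have := normr_ge0 M; rewrite normrN; lra.
- by have := ler_norm M; have := normr_ge0 m; lra.
Qed.

Lemma cst_integrable (D : set LR) r c : measurable D -> mu D = r%:E ->
  mu.-integrable D (EFin \o cst c).
Proof.
move=> mD muD; apply: (@bounded_integrable _ _ r c c) => // x _.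
by rewrite /= lexx.
Qed.

Lemma bounded_Rintegral (D : set LR) (f : LR -> R) r m M :
  measurable D -> mu D = r%:E -> measurable_fun D f ->
  (forall x, D x -> m <= f x <= M) ->
  m * r <= \int[mu]_(x in D) f x <= M * r.
Proof.
move=> mD muD mf fmM.
have E c : c * r = \int[mu]_(x in D) cst c x.
  by rewrite Rintegral_cst// [X in fine X]muD.
rewrite !E; apply/andP; split; apply: le_Rintegral => //;
  try exact: cst_integrable muD; try exact: bounded_integrable muD mf fmM;
  by move=> x /fmM/andP[].
Qed.

Lemma strategyP sigma x : strategy sigma -> 0 <= x <= 1 -> 0 <= sigma x <= 1.
Proof. by move=> [_ + x01]; apply; rewrite in_itv. Qed.

Lemma strategy_measurable sigma (i : interval R) : strategy sigma ->
  [set` i] `<=` `[0, 1] ->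
  measurable_fun ([set` i] : set LR) (sigma : LR -> R).
Proof.
move=> [msigma _] i01.
exact: measurable_funS (measurable_itv_lebesgueR _) i01 msigma.
Qed.

Lemma flee_measurable sigma (i : interval R) : strategy sigma ->
  [set` i] `<=` `[0, 1] ->
  measurable_fun ([set` i] : set LR) ((fun t => 1 - sigma t) : LR -> R).
Proof.
move=> ssigma i01; apply: measurable_realfun.measurable_funB; first exact: measurable_cst.
exact: strategy_measurable.
Qed.

Lemma flee_integrable sigma x : strategy sigma -> 0 <= x <= 1 ->
  mu.-integrable (`[0, x] : set LR) (EFin \o (fun t => 1 - sigma t)).
Proof.
move=> ssigma /andP[x0 x1].
have sub : `[0, x] `<=` `[0, 1].
  by move=> t/=; rewrite !in_itv/= => /andP[-> /le_trans ->].
apply: (@bounded_integrable _ _ (x - 0) 0 1).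
- exact: measurable_itv_lebesgueR.
- exact: completed_lebesgue_measure_itvcc.
- exact: flee_measurable.
- move=> t /sub/=; rewrite in_itv/= => t01.
  have /andP[] := strategyP ssigma t01; lra.
Qed.

Lemma strategy_integrable sigma x : strategy sigma -> 0 <= x <= 1 ->
  mu.-integrable (`[0, x] : set LR) (EFin \o sigma).
Proof.
move=> ssigma /andP[x0 x1].
have sub : `[0, x] `<=` `[0, 1].
  by move=> t/=; rewrite !in_itv/= => /andP[-> /le_trans ->].
apply: (@bounded_integrable _ _ (x - 0) 0 1).
- exact: measurable_itv_lebesgueR.
- exact: completed_lebesgue_measure_itvcc.
- exact: strategy_measurable.
- move=> t /sub/=; rewrite in_itv/= => t01.
  exact: (strategyP ssigma t01).
Qed.

Lemma flee_mass0 sigma : strategy sigma -> flee_mass sigma 0 = 0.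
Proof.
move=> ssigma; have sub : `[0, 0] `<=` (`[0, 1] : set R).
  by move=> t/=; rewrite !in_itv/= => /andP[-> /le_trans->].
have : 0 * (0 - 0) <= flee_mass sigma 0 <= 1 * (0 - 0).
  apply: bounded_Rintegral.
  - exact: measurable_itv_lebesgueR.
  - exact: completed_lebesgue_measure_itvcc.
  - exact: flee_measurable.
  - move=> t /sub/=; rewrite in_itv/= => t01.
    have /andP[] := strategyP ssigma t01; lra.
by rewrite !subrr !mulr0 -eq_le => /eqP.
Qed.

(** By additivity the increment is the integral over []a, b]]. Monotonicity, continuity and
    differentiability of the payoff gap are all drawn from this estimate. *)
Lemma flee_mass_bounds sigma a b m M : strategy sigma ->
  0 <= a -> a <= b -> b <= 1 ->
  (forall t, a <= t <= b -> m <= 1 - sigma t <= M) ->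
  m * (b - a) <= flee_mass sigma b - flee_mass sigma a <= M * (b - a).
Proof.
move=> ssigma a0 ab b1 smM.
have -> : flee_mass sigma b = flee_mass sigma a +
    \int[mu]_(t in `]a, b]) (1 - sigma t).
  rewrite /flee_mass /integral01 -Rintegral_setU; first last.
  - apply/disj_setPS => t /=; rewrite !in_itv/= => -[/andP[_ ta] /andP[at_ _]].
    by move: at_; rewrite ltNge ta.
  - rewrite -itv_bndbnd_setU ?bnd_simp//.
    by apply: flee_integrable => //; rewrite b1 (le_trans a0 ab).
  - exact: measurable_itv_lebesgueR.
  - exact: measurable_itv_lebesgueR.
  by rewrite -itv_bndbnd_setU ?bnd_simp.
rewrite addrAC subrr add0r.
apply: bounded_Rintegral.
- exact: measurable_itv_lebesgueR.
- exact: completed_lebesgue_measure_itvoc.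
- apply: flee_measurable => // t/=; rewrite !in_itv/= => /andP[at_ tb].
  by rewrite (le_trans a0 (ltW at_)) (le_trans tb b1).
- by move=> t /=; rewrite in_itv/= => /andP[at_ tb]; apply: smM; rewrite ltW.
Qed.

Lemma integral01_flee_mass sigma x : strategy sigma -> 0 <= x <= 1 ->
  integral01 sigma x = x - flee_mass sigma x.
Proof.
move=> ssigma x01; rewrite /flee_mass /integral01 RintegralB//; first last.
- exact: strategy_integrable.
- case/andP: x01 => x0 _; apply: cst_integrable.
    exact: measurable_itv_lebesgueR.
  exact: completed_lebesgue_measure_itvcc.
- exact: measurable_itv_lebesgueR.
rewrite Rintegral_cst; last exact: measurable_itv_lebesgueR.
case/andP: x01 => x0 _; rewrite [X in fine X]completed_lebesgue_measure_itvcc//=; lra.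
Qed.

(** The integral of [sigma] over [[0, x]] is [x] minus the fleeing mass, so the payoff [x] of
    fighting cancels. *)
Lemma payoff_gapE B sigma x : strategy sigma -> 0 <= x <= 1 ->
  payoff_gap B sigma x = flee_mass sigma x - B * flee_mass sigma 1.
Proof.
move=> ssigma x01.
rewrite /payoff_gap /payoff_fight /payoff_flee integral01_flee_mass//.
by rewrite -/(flee_mass sigma 1); lra.
Qed.

End flee_integral.

(** * Derivatives relative to a domain *)

Section slope.
Context {R : realType}.
Implicit Types (f g : R -> R) (A B : set R) (x y l : R).

(* [f] has derivative [l] at [x] relative to the domain [A]; unlike
   [is_derive], this glues along unions of domains. *)
Definition has_slope A f x l := forall e, 0 < e ->
  \forall y \near x, A y -> `|f y - f x - l * (y - x)| <= e * `|y - x|.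

Lemma has_slope_is_derive f x l :
  has_slope setT f x l <-> is_derive x 1 f l.
Proof.
split=> [fl|/is_derive1_caratheodory[g [fE gx <-]] e e0].
  apply/is_derive1_caratheodory.
  (* The difference quotient, completed by [l] at [x], is the Caratheodory slope function. *)
  exists (fun z => if z == x then l else (f z - f x) / (z - x)); split.
  - move=> z; case: eqP => [->|/eqP]; first by rewrite !subrr mulr0.
    by rewrite -subr_eq0 => /divfK->.
  - rewrite /prop_for /continuous_at eqxx; apply/cvgrPdist_le => e e0.
    near=> y; case: ifPn => [_|yx]; first by rewrite subrr normr0 ltW.
    have yx0 : y - x != 0 by rewrite subr_eq0.
    rewrite distrC -(ler_pM2r (_ : 0 < `|y - x|)) ?normr_gt0// -normrM.
    by rewrite mulrBl divfK//; near: y; apply: filterS (fl e e0) => y; apply.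
  - by rewrite eqxx.
move/cvgrPdist_le : gx => /(_ e e0); apply: filterS => y gxy _.
by rewrite fE -mulrBl normrM distrC ler_wpM2r.
Unshelve. all: by end_near. Qed.

(** Multiplication by [|y - x|] clears the quotient. This links slopes to the form used in
    [positive_derivative]. *)
Lemma has_slope_cvg A f x l :
  (f y - f x) / (y - x) @[y --> within A x^'] --> l <-> has_slope A f x l.
Proof.
split=> [/cvgrPdist_le fl e e0|fl].
  have := fl e e0; rewrite !near_withinE => fle.
  apply: filterS fle => y fle Ay; have [->|yx] := eqVneq y x.
    by rewrite !subrr mulr0 subrr normr0 mulr0.
  have yx0 : y - x != 0 by rewrite subr_eq0.
  have := fle yx Ay; rewrite distrC -(ler_pM2r (_ : 0 < `|y - x|)) ?normr_gt0//.
  by rewrite -normrM mulrBl divfK.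
apply/cvgrPdist_le => e e0; rewrite !near_withinE.
apply: filterS (fl e e0) => y fle yx Ay.
have yx0 : y - x != 0 by rewrite subr_eq0.
rewrite distrC -(ler_pM2r (_ : 0 < `|y - x|)) ?normr_gt0// -normrM.
by rewrite mulrBl divfK//; exact: fle.
Qed.

Lemma has_slopeS A B f x l : A `<=` B -> has_slope B f x l -> has_slope A f x l.
Proof. by move=> AB fl e /fl; apply: filterS => y + /AB; apply. Qed.

Lemma has_slopeU A B f x l :
  has_slope A f x l -> has_slope B f x l -> has_slope (A `|` B) f x l.
Proof.
by move=> fA fB e e0; apply: filterS2 (fA e e0) (fB e e0) => y yA yB [/yA|/yB].
Qed.

(** Vacuous, but it lets [has_slopeU] glue at a point that lies away from some of the pieces. *)
Lemma has_slope_far A f x l : (\forall y \near x, ~ A y) -> has_slope A f x l.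
Proof. by move=> xA e _; apply: filterS xA => y nAy /nAy. Qed.

Lemma eq_has_slope A f g x l : A x -> {in A, f =1 g} ->
  has_slope A g x l -> has_slope A f x l.
Proof.
move=> Ax fg gl e /gl; apply: filterS => y + Ay => /(_ Ay).
by rewrite !fg ?inE.
Qed.

End slope.

(** * Extension of the payoff gap and of the strategy to the line *)

(** Composing with this retraction extends functions from [[0, 1]] to the line, preserving
    continuity and weak monotonicity. *)
Definition clamp01 {R : realType} (x : R) : R := Num.max 0 (Num.min x 1).

Section clamp.
Context {R : realType}.
Implicit Types x y : R.

Lemma clamp01_itv x : 0 <= clamp01 x <= 1.
Proof.
by rewrite le_max lexx/= ge_max ler01/= ge_min lexx orbT.
Qed.

Lemma clamp01_id x : 0 <= x <= 1 -> clamp01 x = x.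
Proof. by move=> /andP[x0 x1]; rewrite /clamp01 min_l// max_r. Qed.

Lemma clamp01K x : clamp01 (clamp01 x) = clamp01 x.
Proof. exact/clamp01_id/clamp01_itv. Qed.

Lemma clamp01_le0 x : x <= 0 -> clamp01 x = 0.
Proof. by move=> x0; rewrite /clamp01 max_l// ge_min x0. Qed.

Lemma clamp01_ge1 x : 1 <= x -> clamp01 x = 1.
Proof. by move=> x1; rewrite /clamp01 min_r// max_r. Qed.

Lemma clamp01_nd x y : x <= y -> clamp01 x <= clamp01 y.
Proof.
by move=> xy; rewrite /clamp01 ge_max !le_max lexx/= le_min !ge_min xy lexx !orbT.
Qed.

Lemma continuous_clamp01 : continuous (@clamp01 R).
Proof.
move=> x; apply: (@continuous_max _ _ (cst 0) (fun x => Num.min x 1)).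
  exact: cvg_cst.
by apply: (@continuous_min _ _ id (cst 1)); [exact: cvg_id|exact: cvg_cst].
Qed.

End clamp.

Section extension.
Context {R : realType}.
Variables (sigma : R -> R) (B k0 k1 : R).
Hypotheses (ssigma : strategy sigma) (csigma : continuous_increasing sigma).
Hypothesis isigma : interior_strategy sigma.
Hypotheses (k0_gt0 : 0 < k0) (k1_gt0 : 0 < k1).
Implicit Types x y t : R.

Let s x := sigma (clamp01 x).

Let s_nd x y : x <= y -> s x <= s y.
Proof.
move=> /clamp01_nd; rewrite le_eqVlt => /predU1P[|xy].
  by rewrite /s => ->.
by apply/ltW/csigma.2 => //; rewrite in_itv/= clamp01_itv.
Qed.

Let s01 x : 0 < s x < 1.
Proof. by apply: isigma; rewrite in_itv/= clamp01_itv. Qed.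

Let s_continuous : continuous s.
Proof.
move=> x; have [/subspace_continuousP cs _] := csigma.
have c01 y : (`[0, 1]%classic : set R) (clamp01 y).
  by rewrite /= in_itv/= clamp01_itv.
apply: cvg_comp (cs _ (c01 x)).
move=> P PN; have := continuous_clamp01 PN.
by apply: (@filterS _ (nbhs x)) => y; apply; exact: c01.
Qed.

Let s_id x : 0 <= x <= 1 -> s x = sigma x.
Proof. by move=> x01; rewrite /s clamp01_id. Qed.

(* Affine outside [0, 1], with slopes making it an antiderivative of
   [fun x => 1 - sigma (clamp01 x)] on the whole line. *)
Definition gap_ext x := flee_mass sigma (clamp01 x) - B * flee_mass sigma 1
  + (1 - sigma 0) * Num.min x 0 + (1 - sigma 1) * (Num.max x 1 - 1).

Lemma gap_ext_id x : 0 <= x <= 1 -> gap_ext x = payoff_gap B sigma x.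
Proof.
move=> /[dup] x01 /andP[x0 x1].
rewrite payoff_gapE// /gap_ext clamp01_id// min_r// max_r//.
by rewrite subrr !mulr0 !addr0.
Qed.

(** An antiderivative of a nonincreasing function has increments between the two end slopes. The
    increment is split into its parts below 0, inside [[0, 1]] and above 1. *)
Lemma gap_ext_bounds x y : x <= y ->
  (1 - sigma (clamp01 y)) * (y - x) <= gap_ext y - gap_ext x
    <= (1 - sigma (clamp01 x)) * (y - x).
Proof.
move=> xy; rewrite -/(s x) -/(s y).
have /andP[cx0 cx1] := clamp01_itv x; have /andP[cy0 cy1] := clamp01_itv y.
have sxy := s_nd xy; have /andP[sx0 sx1] := s01 x; have /andP[sy0 sy1] := s01 y.
have s0x : sigma 0 <= s x.
  by have := s_nd cx0; rewrite /s clamp01K clamp01_id ?lexx ?ler01.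
have sy1' : s y <= sigma 1.
  by have := s_nd cy1; rewrite /s clamp01K (@clamp01_id _ 1) ?lexx ?ler01.
have /andP[lo hi] : (1 - s y) * (clamp01 y - clamp01 x)
    <= flee_mass sigma (clamp01 y) - flee_mass sigma (clamp01 x)
    <= (1 - s x) * (clamp01 y - clamp01 x).
  apply: flee_mass_bounds => //; first exact: clamp01_nd.
  move=> t /andP[xt ty]; rewrite -(@s_id t); last first.
    by rewrite (le_trans cx0 xt) (le_trans ty cy1).
  have := s_nd xt; have := s_nd ty; rewrite /s !clamp01K.
  by move=> ? ?; apply/andP; split; lra.
have dec (z : R) : z = clamp01 z + Num.min z 0 + (Num.max z 1 - 1).
  have [z0|z0] := leP z 0.
    rewrite clamp01_le0//  max_r; first lra.
    exact: le_trans z0 _.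
  have [z1|z1] := leP z 1; first by rewrite clamp01_id ?(ltW z0)//; lra.
  by rewrite clamp01_ge1 ?(ltW z1)//; lra.
have mn : Num.min x 0 <= Num.min y 0.
  by rewrite le_min !ge_min xy lexx orbT.
have mx : Num.max x 1 <= Num.max y 1.
  by rewrite ge_max !le_max xy lexx orbT.
have -> : y - x = (clamp01 y - clamp01 x) + (Num.min y 0 - Num.min x 0)
                + (Num.max y 1 - Num.max x 1).
  by rewrite {1}(dec y) {1}(dec x); ring.
(* On each outer part the affine slope lies between [1 - s y] and [1 - s x], unless that part is
   empty and its length is 0. *)
have mnlo : (1 - s y) * (Num.min y 0 - Num.min x 0) <=
            (1 - sigma 0) * (Num.min y 0 - Num.min x 0).
  by rewrite ler_wpM2r ?subr_ge0// lerB// (le_trans s0x).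
have mnhi : (1 - sigma 0) * (Num.min y 0 - Num.min x 0) <=
            (1 - s x) * (Num.min y 0 - Num.min x 0).
  have [x0|x0] := leP x 0; first by rewrite /s (clamp01_le0 x0).
  by rewrite min_r ?(ltW (lt_le_trans x0 xy))// subrr !mulr0.
have mxlo : (1 - s y) * (Num.max y 1 - Num.max x 1) <=
            (1 - sigma 1) * (Num.max y 1 - Num.max x 1).
  have [y1|y1] := leP 1 y; first by rewrite /s (clamp01_ge1 y1).
  by rewrite max_r ?(ltW (le_lt_trans xy y1))// subrr !mulr0.
have mxhi : (1 - sigma 1) * (Num.max y 1 - Num.max x 1) <=
            (1 - s x) * (Num.max y 1 - Num.max x 1).
  by rewrite ler_wpM2r ?subr_ge0// lerB// (le_trans sxy).
by rewrite /gap_ext; apply/andP; split; lra.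
Qed.

(** By [gap_ext_bounds] the linearization error is at most [|s y - s x| * |y - x|], and [s] is
    continuous. *)
Lemma gap_ext_is_derive x : is_derive x 1 gap_ext (1 - sigma (clamp01 x)).
Proof.
apply/has_slope_is_derive => e e0.
have /cvgrPdist_le/(_ e e0) := @s_continuous x.
apply: filterS => y; rewrite -/(s x) => sxy _.
have [xy|/ltW yx] := leP x y.
  have /andP[] := gap_ext_bounds xy; rewrite -/(s x) -/(s y) => lo hi.
  apply: le_trans (_ : (s y - s x) * (y - x) <= _).
    by rewrite ler_norml; apply/andP; split; have := s_nd xy; nra.
  rewrite [in leRHS]ger0_norm ?subr_ge0// ler_wpM2r ?subr_ge0//.
  by apply: le_trans sxy; rewrite distrC ler_norm.
have /andP[] := gap_ext_bounds yx; rewrite -/(s x) -/(s y) => lo hi.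
apply: le_trans (_ : (s x - s y) * (x - y) <= _).
  by rewrite ler_norml; apply/andP; split; have := s_nd yx; nra.
rewrite [in leRHS]distrC [in leRHS]ger0_norm ?subr_ge0// ler_wpM2r ?subr_ge0//.
by apply: le_trans sxy; rewrite ler_norm.
Qed.

Lemma gap_ext_continuous : continuous gap_ext.
Proof.
move=> x; have [dx _] := gap_ext_is_derive x.
exact/differentiable_continuous/derivable1_diffP.
Qed.

(** The slope is smallest to the right of 1, where it equals [1 - sigma 1 > 0]. Injectivity and
    surjectivity both follow from this uniform bound. *)
Lemma gap_ext_growth x y : x <= y ->
  (1 - sigma 1) * (y - x) <= gap_ext y - gap_ext x.
Proof.
move=> xy; have /andP[+ _] := gap_ext_bounds xy; apply: le_trans.
apply: ler_wpM2r; first by rewrite subr_ge0.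
rewrite lerB//; have [y1|/ltW y1] := leP y 1; last by rewrite clamp01_ge1.
by rewrite -(@s_id 1) ?lexx ?ler01//; exact: s_nd.
Qed.

Let s1_lt1 : 0 < 1 - sigma 1.
Proof. by have := s01 1; rewrite s_id ?lexx ?ler01//; lra. Qed.

Lemma gap_ext_inc x y : x < y -> gap_ext x < gap_ext y.
Proof.
move=> xy; rewrite -subr_gt0; apply: lt_le_trans (gap_ext_growth (ltW xy)).
by rewrite mulr_gt0// subr_gt0.
Qed.

Lemma gap_ext_surj t : exists x, gap_ext x = t.
Proof.
(* With this [b], growth at rate [m] carries [gap_ext] below [t] at [- b] and above [t] at [b]. *)
pose m := 1 - sigma 1; pose b := (`|t| + `|gap_ext 0|) / m.
have b0 : 0 <= b by apply: divr_ge0 (ltW s1_lt1); apply: addr_ge0.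
have mb : m * b = `|t| + `|gap_ext 0| by rewrite mulrC divfK// gt_eqF.
have hi := gap_ext_growth b0.
have lo : m * (0 - - b) <= gap_ext 0 - gap_ext (- b).
  by apply: gap_ext_growth; rewrite oppr_le0.
rewrite -/m !subr0 mb in hi; rewrite -/m sub0r opprK mb in lo.
have := ler_norm t; have := ler_norm (- t); rewrite normrN => t1 t2.
have := ler_norm (gap_ext 0); have := ler_norm (- gap_ext 0); rewrite normrN => g1 g2.
have [|||x _ <-] := @IVT _ gap_ext (- b) b t; last by exists x.
- by lra.
- by apply: continuous_subspaceT; exact: gap_ext_continuous.
- by rewrite min_l ?max_r; [apply/andP; split; lra|lra|lra].
Qed.

Lemma gap_ext_inverse : exists2 h : R -> R, cancel h gap_ext & cancel gap_ext h.
Proof.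
have [h hK] := choice gap_ext_surj; exists h => // x.
have [/gap_ext_inc|/gap_ext_inc|//] := ltgtP (h (gap_ext x)) x;
  by rewrite hK ltxx.
Qed.

(** Hyperbolas: [left_tail] climbs from 0 at minus infinity to [sigma 0] at 0, and [right_tail] from
    [sigma 1] at 1 to 1 at infinity, so the values stay inside (0, 1). *)
Let left_tail x := sigma 0 / (1 - k0 * x).
Let right_tail x := 1 - (1 - sigma 1) / (1 + k1 * (x - 1)).

(* The slopes [sigma 0 * k0] at 0 and [(1 - sigma 1) * k1] at 1 of the two tails
   are free, so that they can be matched with the one-sided derivatives of
   [sigma]. *)
Definition strategy_ext x := sigma (clamp01 x)
  + (left_tail (Num.min x 0) - sigma 0) + (right_tail (Num.max x 1) - sigma 1).

Let sigma0 : 0 < sigma 0 < 1.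
Proof. by rewrite -(@s_id 0) ?lexx ?ler01. Qed.

Let sigma1 : 0 < sigma 1 < 1.
Proof. by rewrite -(@s_id 1) ?lexx ?ler01. Qed.

Let left_den x : x <= 0 -> 1 <= 1 - k0 * x.
Proof. by move=> x0; rewrite lerDl oppr_ge0 pmulr_rle0. Qed.

Let right_den x : 1 <= x -> 1 <= 1 + k1 * (x - 1).
Proof. by move=> x1; rewrite lerDl pmulr_rge0// subr_ge0. Qed.

Let left_tail0 : left_tail 0 = sigma 0.
Proof. by rewrite /left_tail mulr0 subr0 divr1. Qed.

Let right_tail1 : right_tail 1 = sigma 1.
Proof. by rewrite /right_tail subrr mulr0 addr0 divr1; lra. Qed.

Let left_tail_inc x y : x < y -> y <= 0 -> left_tail x < left_tail y.
Proof.
move=> xy y0; have := left_den y0; have := left_den (le_trans (ltW xy) y0).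
move=> dx dy; rewrite /left_tail ltr_pM2l; last by case/andP: sigma0.
by rewrite ltf_pV2 ?posrE ?(lt_le_trans ltr01)// ltrD2l ltrN2 ltr_pM2l.
Qed.

Let right_tail_inc x y : x < y -> 1 <= x -> right_tail x < right_tail y.
Proof.
move=> xy x1; have := right_den x1; have := right_den (le_trans x1 (ltW xy)).
move=> dx dy; rewrite /right_tail ltrD2l ltrN2 ltr_pM2l//.
by rewrite ltf_pV2 ?posrE ?(lt_le_trans ltr01)// ltrD2l ltr_pM2l// ltrD2r.
Qed.

(** Each correction vanishes off its own half-line; on it, the clamped term is frozen at the value
    which the correction subtracts. *)
Let strategy_extW x : [/\ x <= 0 -> strategy_ext x = left_tail x,
  0 <= x <= 1 -> strategy_ext x = sigma x &
  1 <= x -> strategy_ext x = right_tail x].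
Proof.
rewrite /strategy_ext; split => [x0|/andP[x0 x1]|x1].
- rewrite clamp01_le0// min_l// max_r ?(le_trans x0)// right_tail1; lra.
- by rewrite clamp01_id ?x0// min_r// max_r// right_tail1 left_tail0; lra.
- rewrite clamp01_ge1// max_l// min_r ?(le_trans _ x1)// left_tail0; lra.
Qed.

Let strategy_ext_left x : x <= 0 -> strategy_ext x = left_tail x.
Proof. by case: (strategy_extW x). Qed.

Lemma strategy_ext_id x : 0 <= x <= 1 -> strategy_ext x = sigma x.
Proof. by case: (strategy_extW x). Qed.

Let strategy_ext_right x : 1 <= x -> strategy_ext x = right_tail x.
Proof. by case: (strategy_extW x). Qed.

Lemma strategy_ext_inc x y : x < y -> strategy_ext x < strategy_ext y.
Proof.
have nd u v : u <= v -> sigma (clamp01 u) <= sigma (clamp01 v) by exact: s_nd.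
have ndl u v : u <= v -> left_tail (Num.min u 0) <= left_tail (Num.min v 0).
  move=> uv; have : Num.min u 0 <= Num.min v 0.
    by rewrite le_min !ge_min uv lexx orbT.
  rewrite le_eqVlt => /predU1P[->//|/left_tail_inc]; move/(_ _)/ltW; apply.
  by rewrite ge_min lexx orbT.
have ndr u v : u <= v -> right_tail (Num.max u 1) <= right_tail (Num.max v 1).
  move=> uv; have : Num.max u 1 <= Num.max v 1.
    by rewrite ge_max !le_max uv lexx orbT.
  rewrite le_eqVlt => /predU1P[->//|/right_tail_inc]; move/(_ _)/ltW; apply.
  by rewrite le_max lexx orbT.
move=> xy; have nxy := nd _ _ (ltW xy).
have ndlxy := ndl _ _ (ltW xy); have ndrxy := ndr _ _ (ltW xy).
rewrite /strategy_ext.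
(* All three terms are nondecreasing; the position of the smaller point [x] decides which of them
   increases strictly. *)
have [x0|] := boolP (x < 0); last rewrite -leNgt => x0.
  apply: ltr_leD; last by rewrite lerD2r.
  apply: ler_ltD => //; rewrite ltrD2r; apply: left_tail_inc.
    by rewrite lt_min !gt_min xy x0.
  by rewrite ge_min lexx orbT.
have [x1|] := boolP (x < 1); last rewrite -leNgt => x1.
  apply: ltr_leD; last by rewrite lerD2r.
  apply: ltr_leD; last by rewrite lerD2r.
  apply: csigma.2; rewrite ?in_itv/= ?clamp01_itv//.
  by rewrite clamp01_id ?x0 ?ltW// /clamp01 lt_max lt_min xy x1 orbT.
apply: ler_ltD; first by apply: lerD => //; rewrite lerD2r.
rewrite ltrD2r; apply: right_tail_inc.
  by rewrite (max_l x1) lt_max xy.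
by rewrite le_max lexx orbT.
Qed.

Lemma strategy_ext_itv x : 0 < strategy_ext x < 1.
Proof.
have [x0|/ltW x0] := leP x 0.
  have dx := left_den x0; rewrite strategy_ext_left// /left_tail.
  have d0 : 0 < 1 - k0 * x by exact: lt_le_trans dx.
  case/andP: sigma0 => s0 s1; rewrite divr_gt0//= ltr_pdivrMr// mul1r.
  exact: lt_le_trans dx.
have [x1|/ltW x1] := leP x 1.
  by rewrite strategy_ext_id ?x0//; apply: isigma; rewrite in_itv/= x0.
have dx := right_den x1; rewrite strategy_ext_right// /right_tail.
have d0 : 0 < 1 + k1 * (x - 1) by exact: lt_le_trans dx.
case/andP: sigma1 => s0 s1; rewrite subr_gt0 ltr_pdivrMr// mul1r.
apply/andP; split; first by apply: lt_le_trans dx; lra.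
by rewrite ltrBlDr ltrDl divr_gt0.
Qed.

Let left_tail_is_derive x : x <= 0 ->
  is_derive x 1 left_tail (sigma 0 * k0 / (1 - k0 * x) ^+ 2).
Proof.
move=> /left_den dx; have d0 : 1 - k0 * x != 0 by rewrite gt_eqF// (lt_le_trans _ dx).
have dD : is_derive x 1 (fun y => 1 - k0 * y) (- k0).
  by apply: is_derive_eq; rewrite /GRing.scale/=; ring.
have dV := @is_deriveV _ (fun y => 1 - k0 * y) x _ 1 d0 dD.
have -> : left_tail = (sigma 0) *: (fun y => (1 - k0 * y)^-1) by [].
apply: is_derive_eq; rewrite /GRing.scale/=; field.
exact: d0.
Qed.

Let right_tail_is_derive x : 1 <= x ->
  is_derive x 1 right_tail ((1 - sigma 1) * k1 / (1 + k1 * (x - 1)) ^+ 2).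
Proof.
move=> /right_den dx; have d0 : 1 + k1 * (x - 1) != 0 by rewrite gt_eqF// (lt_le_trans _ dx).
have dD : is_derive x 1 (fun y => 1 + k1 * (y - 1)) k1.
  by apply: is_derive_eq; rewrite /GRing.scale/=; ring.
have dV := @is_deriveV _ (fun y => 1 + k1 * (y - 1)) x _ 1 d0 dD.
have -> : right_tail = cst 1 - (1 - sigma 1) *: (fun y => (1 + k1 * (y - 1))^-1) by [].
apply: is_derive_eq; rewrite /GRing.scale/=; field.
exact: d0.
Qed.

Lemma strategy_ext_continuous : continuous strategy_ext.
Proof.
move=> x; apply: cvgD; first apply: cvgD; first exact: s_continuous.
  apply: cvgB; last exact: cvg_cst.
  apply: (@continuous_comp _ _ _ (fun y => Num.min y 0) left_tail).
    by apply: (@continuous_min _ _ id (cst 0)); [exact: cvg_id|exact: cvg_cst].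
  have m0 : Num.min x 0 <= 0 by rewrite ge_min lexx orbT.
  have [dx _] := left_tail_is_derive m0.
  exact/differentiable_continuous/derivable1_diffP.
apply: cvgB; last exact: cvg_cst.
apply: (@continuous_comp _ _ _ (fun y => Num.max y 1) right_tail).
  by apply: (@continuous_max _ _ id (cst 1)); [exact: cvg_id|exact: cvg_cst].
have m1 : 1 <= Num.max x 1 by rewrite le_max lexx orbT.
have [dx _] := right_tail_is_derive m1.
exact/differentiable_continuous/derivable1_diffP.
Qed.

(** * Differentiability of the extended strategy *)

Section derivable_strategy.
Hypothesis slope0 : has_slope `[0, 1] sigma 0 (sigma 0 * k0).
Hypothesis slope1 : has_slope `[0, 1] sigma 1 ((1 - sigma 1) * k1).
Hypothesis dsigma : positive_derivative sigma.

(** The three closed pieces cover the line, and a derivative can be glued from slopes relative to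
    them. At 0 and 1 the slopes of adjacent pieces agree by the choice of [k0] and [k1]. *)
Lemma strategy_ext_is_derive x :
  exists2 l, 0 < l & is_derive x 1 strategy_ext l.
Proof.
have slopeL y : y <= 0 ->
    has_slope `]-oo, 0] strategy_ext y (sigma 0 * k0 / (1 - k0 * y) ^+ 2).
  move=> y0; apply: (@eq_has_slope _ _ _ left_tail).
  - by rewrite /= in_itv.
  - by move=> z; rewrite inE/= in_itv/= => /strategy_ext_left.
  - apply: (@has_slopeS _ _ setT) => //.
    by apply/has_slope_is_derive; exact: left_tail_is_derive.
have slopeR y : 1 <= y ->
    has_slope `[1, +oo[ strategy_ext y ((1 - sigma 1) * k1 / (1 + k1 * (y - 1)) ^+ 2).
  move=> y1; apply: (@eq_has_slope _ _ _ right_tail).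
  - by rewrite /= in_itv/= y1.
  - by move=> z; rewrite inE/= in_itv/= andbT => /strategy_ext_right.
  - apply: (@has_slopeS _ _ setT) => //.
    by apply/has_slope_is_derive; exact: right_tail_is_derive.
have slopeM y l : 0 <= y <= 1 -> has_slope `[0, 1] sigma y l ->
    has_slope `[0, 1] strategy_ext y l.
  move=> y01; apply: eq_has_slope; first by rewrite /= in_itv.
  by move=> z; rewrite inE/= in_itv/= => /strategy_ext_id.
have cover : setT = `]-oo, 0] `|` (`[0, 1] `|` `[1, +oo[) :> set R.
  apply/seteqP; split => // z _ /=; rewrite !in_itv/= andbT.
  have [z0|/ltW z0] := leP z 0; first by left.
  by right; rewrite z0/=; have [z1|/ltW z1] := leP z 1; [left|right].
have farL y : 0 < y -> nbhs y (~` `]-oo, 0]).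
  move=> y0; near=> z; rewrite /setC/= in_itv/=; apply/negP; rewrite -ltNge.
  by near: z; exact: lt_nbhsr.
have farR y : y < 1 -> nbhs y (~` `[1, +oo[).
  move=> y1; near=> z; rewrite /setC/= in_itv/= andbT; apply/negP; rewrite -ltNge.
  by near: z; exact: lt_nbhsl.
have farM0 y : y < 0 -> nbhs y (~` `[0, 1]).
  move=> y0; near=> z; rewrite /setC/= in_itv/= => /andP[+ _]; apply/negP; rewrite -ltNge.
  by near: z; exact: lt_nbhsl.
have farM1 y : 1 < y -> nbhs y (~` `[0, 1]).
  move=> y0; near=> z; rewrite /setC/= in_itv/= => /andP[_]; apply/negP; rewrite -ltNge.
  by near: z; exact: lt_nbhsr.
have glue y l : has_slope `]-oo, 0] strategy_ext y l ->
    has_slope `[0, 1] strategy_ext y l -> has_slope `[1, +oo[ strategy_ext y l ->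
    is_derive y 1 strategy_ext l.
  move=> sL sM sR; apply/has_slope_is_derive; rewrite cover.
  by do 2 apply: has_slopeU => //.
have lt01 : (0 : R) < 1 := ltr01.
case/andP: sigma0 => s00 _; case/andP: sigma1 => _ s11.
have [x0|x0|->] := ltgtP x 0.
- exists (sigma 0 * k0 / (1 - k0 * x) ^+ 2).
    have := left_den (ltW x0) => dx.
    by rewrite divr_gt0 ?exprn_gt0 ?(lt_le_trans ltr01 dx)// mulr_gt0.
  apply: glue; [exact/slopeL/ltW|exact/has_slope_far/farM0|].
  by apply/has_slope_far/farR; exact: lt_trans lt01.
- have [x1|x1|->] := ltgtP x 1.
  + have x01 : 0 <= x <= 1 by rewrite !ltW.
    have [|l l0 /has_slope_cvg sl] := dsigma (x := x); first by rewrite in_itv.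
    exists l => //; apply: glue; [exact/has_slope_far/farL|exact: slopeM|].
    exact/has_slope_far/farR.
  + exists ((1 - sigma 1) * k1 / (1 + k1 * (x - 1)) ^+ 2).
      have := right_den (ltW x1) => dx.
      by rewrite divr_gt0 ?exprn_gt0 ?(lt_le_trans ltr01 dx)// mulr_gt0.
    apply: glue; [exact/has_slope_far/farL|exact/has_slope_far/farM1|].
    exact/slopeR/ltW.
  + exists ((1 - sigma 1) * k1); first exact: mulr_gt0.
    apply: glue; [exact/has_slope_far/farL|by apply: slopeM; rewrite ?ler01 ?lexx|].
    by have := slopeR 1 (lexx _); rewrite subrr mulr0 addr0 expr1n divr1.
- exists (sigma 0 * k0); first exact: mulr_gt0.
  apply: glue; last exact/has_slope_far/farR.
    by have := slopeL 0 (lexx _); rewrite mulr0 subr0 expr1n divr1.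
  by apply: slopeM; rewrite ?ler01 ?lexx.
Unshelve. all: by end_near. Qed.

End derivable_strategy.

End extension.

(** * From strategies to response functions *)

Section responses.
Context {R : realType}.
Implicit Types (Q : R * R -> R) (q sigma : R -> R) (B x t : R).

Lemma diff_responsive_mono Q : diff_responsive Q -> mono_responsive Q.
Proof.
move=> dQ; split.
  have d1 x := let: And4 d _ _ _ := dQ (x, w) in d.
  have p1 x := let: And4 _ _ p _ := dQ (x, w) in p.
  apply: (@gtr0_derive1_lt_cc _ (fun t => Q (t, w)) a b) => //=.
  - by move=> x _; exact: d1.
  - by move=> x _; exact: p1.
  - apply: continuous_subspaceT => x.
    exact/differentiable_continuous/derivable1_diffP/d1.
  - by rewrite in_itv/= lexx ltW.
  - by rewrite in_itv/= lexx ltW.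
have d2 x := let: And4 _ d _ _ := dQ (w, x) in d.
have p2 x := let: And4 _ _ _ p := dQ (w, x) in p.
apply: (@ltr0_derive1_lt_cc _ (fun t => Q (w, t)) a b) => //=.
- by move=> x _; exact: d2.
- by move=> x _; exact: p2.
- apply: continuous_subspaceT => x.
  exact/differentiable_continuous/derivable1_diffP/d2.
- by rewrite in_itv/= lexx ltW.
- by rewrite in_itv/= lexx ltW.
Qed.

(** Thanks to this, continuity, monotonicity and indifference need only be derived from the ordinal
    form. *)
Lemma qre_diff_mono B sigma :
  qre (@diff_responsive R) B sigma -> qre (@mono_responsive R) B sigma.
Proof.
by move=> [Q [sQ [iQ cQ dQ pQ tQ]]]; exists Q; split=> //; split=> //;
  exact: diff_responsive_mono.
Qed.

(** Subtracting the payoff of fleeing from both coordinates turns the payoff pair into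
    [(payoff_gap B sigma x, 0)], which leaves a response in one variable. *)
Lemma qre_gap responsive B sigma : qre responsive B sigma ->
  exists2 Q : R * R -> R, responsive Q &
  [/\ {in `[0, 1], forall x, sigma x = Q (payoff_gap B sigma x, 0)},
      (forall t, 0 < Q (t, 0) < 1), continuous (fun t => Q (t, 0)) &
      forall t, (0 < t) <-> (2^-1 < Q (t, 0))].
Proof.
move=> [Q [sQ [iQ cQ dQ pQ tQ]]]; exists Q => //; split => //.
- move=> x /sQ ->; rewrite -(tQ _ (- payoff_flee B sigma x)) /= subrr.
  by rewrite /payoff_gap.
- move=> t; apply: (@continuous_comp _ _ _ (fun t => (t, 0)) Q); last exact: cQ.
  by apply: (@cvg_pair _ _ _ (nbhs t) (nbhs t) (nbhs (0 : R)));
      [exact: cvg_id|exact: cvg_cst].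
- move=> t; have /= -> := pQ (t, 0); split; lra.
Qed.

(** The inverse passage, from one variable back to two; translation invariance is automatic. *)
Definition gap_response q (v : R * R) : R := q (v.1 - v.2).

Section gap_response.
Variables (B : R) (sigma q : R -> R).
Hypotheses (q_itv : forall t, 0 < q t < 1) (q_continuous : continuous q).
Hypotheses (q_inc : forall t u, t < u -> q t < q u) (q0 : q 0 = 2^-1).
Hypothesis sigma_q : {in `[0, 1], forall x, sigma x = q (payoff_gap B sigma x)}.

Lemma gap_response_qre responsive :
  responsive (gap_response q) -> qre responsive B sigma.
Proof.
move=> rq; exists (gap_response q); split; first exact: sigma_q.
split => //.
- by move=> v; exact: q_itv.
- move=> v; apply: (@continuous_comp _ _ _ (fun v : R * R => v.1 - v.2) q).
    by apply: cvgB; [exact: cvg_fst|exact: cvg_snd].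
  exact: q_continuous.
- move=> v; rewrite /gap_response; split => [v12|].
    have /q_inc : 0 < v.1 - v.2 by rewrite subr_gt0.
    by rewrite q0; lra.
  apply: contraPT; rewrite -leNgt => v12; apply/negP; rewrite -leNgt.
  have : v.1 - v.2 <= 0 by rewrite subr_le0.
  by rewrite le_eqVlt => /predU1P[->|/q_inc]; rewrite q0; lra.
- by move=> v c; rewrite /gap_response/=; congr q; ring.
Qed.

Lemma gap_response_mono : qre (@mono_responsive R) B sigma.
Proof.
apply: gap_response_qre => a b w ab; rewrite /gap_response/=.
by split; apply: q_inc; lra.
Qed.

Lemma gap_response_diff : (forall t, exists2 l, 0 < l & is_derive t 1 q l) ->
  qre (@diff_responsive R) B sigma.
Proof.
move=> dq; apply: gap_response_qre => v; rewrite /gap_response/=.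
have [l l0 dl] := dq (v.1 - v.2).
have d1 : is_derive v.1 1 (fun t => q (t - v.2)) l.
  have dt : is_derive v.1 1 (fun t : R => t - v.2) 1.
    by apply: is_derive_eq; ring.
  have := @is_derive1_comp _ q (fun t : R => t - v.2) v.1 l 1 dl dt.
  by rewrite mulr1.
have d2 : is_derive v.2 1 (fun t => q (v.1 - t)) (- l).
  have dt : is_derive v.2 1 (fun t : R => v.1 - t) (- 1).
    by apply: is_derive_eq; ring.
  have := @is_derive1_comp _ q (fun t : R => v.1 - t) v.2 l (- 1) dl dt.
  by rewrite mulrN1.
split; [by case: d1|by case: d2| |].
- by rewrite derive1E; case: d1 => _ ->.
- by rewrite derive1E; case: d2 => _ ->; rewrite oppr_lt0.
Qed.

End gap_response.

(** * Rationalizing a strategy by a function of the payoff gap *)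

Section characterization.
Variables (B : R) (sigma : R -> R).
Hypothesis ssigma : strategy sigma.
Hypothesis csigma : continuous_increasing sigma.
Hypothesis isigma : interior_strategy sigma.
Hypothesis indiff : exists2 x, indifferent B sigma x & sigma x = 2^-1.

(** The candidate [q], where [h] stands for the inverse of [gap_ext sigma B]. *)
Let response k0 k1 h t := strategy_ext sigma k0 k1 (h t).

Let ext_response k0 k1 h : 0 < k0 -> 0 < k1 ->
    cancel h (gap_ext sigma B) -> cancel (gap_ext sigma B) h ->
  [/\ forall t, 0 < response k0 k1 h t < 1, continuous (response k0 k1 h),
      (forall t u, t < u -> response k0 k1 h t < response k0 k1 h u),
      response k0 k1 h 0 = 2^-1 &
      {in `[0, 1], forall x, sigma x = response k0 k1 h (payoff_gap B sigma x)}].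
Proof.
move=> k00 k10 hK Kh.
have sq x : 0 <= x <= 1 ->
    response k0 k1 h (payoff_gap B sigma x) = sigma x.
  by move=> x01; rewrite -(gap_ext_id B ssigma x01) /response Kh strategy_ext_id.
have h_inc t u : t < u -> h t < h u.
  move=> tu; have [//|hut|htu] := ltgtP (h t) (h u).
    have := gap_ext_inc B ssigma csigma isigma hut.
    by rewrite !hK => /(lt_trans tu); rewrite ltxx.
  by move: tu; rewrite -(hK t) -(hK u) htu ltxx.
split.
- by move=> t; exact: strategy_ext_itv.
- move=> t; apply: (@continuous_comp _ _ _ h (strategy_ext sigma k0 k1)).
    (* [h] is continuous as the inverse of a continuous injection of the line. *)
    have gc := @gap_ext_continuous _ _ B ssigma csigma isigma.
    have : {near gap_ext sigma B (h t), continuous h}.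
      by apply: near_can_continuous; near=> z; [exact: Kh|exact: gc].
    by move=> /nbhs_singleton; rewrite hK.
  exact: strategy_ext_continuous.
- by move=> t u /h_inc; exact: strategy_ext_inc.
- have [x [x01 gx0] sx] := indiff.
  by rewrite -gx0 sq// -sx// ; move: x01; rewrite in_itv.
- by move=> x; rewrite in_itv/= => x01; rewrite sq.
Unshelve. all: by end_near. Qed.

Lemma characterization_mono : qre (@mono_responsive R) B sigma.
Proof.
have [h hK Kh] := gap_ext_inverse B ssigma csigma isigma.
have [itv cont inc r0 sr] := ext_response ltr01 ltr01 hK Kh.
exact: gap_response_mono itv cont inc r0 sr.
Qed.

Lemma characterization_diff :
  positive_derivative sigma -> qre (@diff_responsive R) B sigma.
Proof.
move=> dsigma; have [h hK Kh] := gap_ext_inverse B ssigma csigma isigma.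
have [s0 s1] : 0 < sigma 0 < 1 /\ 0 < sigma 1 < 1.
  by split; apply: isigma; rewrite in_itv/= ?lexx ler01.
case/andP: s0 => s0 _; case/andP: s1 => _ s1.
have [|l0 l00 /has_slope_cvg slope0] := dsigma 0.
  by rewrite in_itv/= lexx ler01.
have [|l1 l10 /has_slope_cvg slope1] := dsigma 1.
  by rewrite in_itv/= lexx ler01.
(* Chosen so that the tail slopes [sigma 0 * k0] and [(1 - sigma 1) * k1] equal the one-sided
   derivatives [l0] and [l1]. *)
pose k0 := l0 / sigma 0; pose k1 := l1 / (1 - sigma 1).
have k00 : 0 < k0 by rewrite divr_gt0.
have k10 : 0 < k1 by rewrite divr_gt0// subr_gt0.
have [itv cont inc r0 sr] := ext_response k00 k10 hK Kh.
apply: gap_response_diff itv cont inc r0 sr _ => t.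
have slope0' : has_slope `[0, 1] sigma 0 (sigma 0 * k0).
  by rewrite mulrC divfK// gt_eqF.
have slope1' : has_slope `[0, 1] sigma 1 ((1 - sigma 1) * k1).
  by rewrite mulrC divfK// gt_eqF// subr_gt0.
have [l l_gt0 dl] :=
  strategy_ext_is_derive isigma k00 k10 slope0' slope1' dsigma (h t).
have g0 : 0 < 1 - sigma (clamp01 (h t)).
  have /isigma/andP[] : clamp01 (h t) \in `[0, 1] by rewrite in_itv/= clamp01_itv.
  by rewrite subr_gt0.
exists (l * (1 - sigma (clamp01 (h t)))^-1).
  by rewrite mulr_gt0 ?invr_gt0.
apply: (@is_derive1_comp _ (strategy_ext sigma k0 k1) h) => //.
rewrite -[t in is_derive t]hK.
apply: (@is_derive_inverse _ (gap_ext sigma B)).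
- by near=> z; exact: Kh.
- by near=> z; exact: gap_ext_continuous.
- exact: gap_ext_is_derive.
- by rewrite gt_eqF.
Unshelve. all: by end_near. Qed.

End characterization.

End responses.

(** * Properties of equilibria *)

Section necessity.
Context {R : realType}.
Variables (B : R) (sigma : R -> R).
Hypotheses (B_gt0 : 0 < B) (B_lt1 : B < 1).
Hypothesis ssigma : strategy sigma.

Let flee_mass_lip x y : 0 <= x -> x <= y -> y <= 1 ->
  0 <= flee_mass sigma y - flee_mass sigma x <= y - x.
Proof.
move=> x0 xy y1.
suff : 0 * (y - x) <= flee_mass sigma y - flee_mass sigma x <= 1 * (y - x).
  by rewrite mul0r mul1r.
apply: flee_mass_bounds => // t /andP[xt ty].
have /andP[] : 0 <= sigma t <= 1.
  by apply: strategyP => //; rewrite (le_trans x0 xt) (le_trans ty y1).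
by move=> ? ?; apply/andP; split; lra.
Qed.

(** Extended by constants: the facts about [gap_ext] require [sigma] to be continuous and
    increasing, which is still to be shown here. *)
Let gap x := flee_mass sigma (clamp01 x) - B * flee_mass sigma 1.

Let gap_id x : 0 <= x <= 1 -> gap x = payoff_gap B sigma x.
Proof. by move=> x01; rewrite /gap clamp01_id// payoff_gapE. Qed.

Let gap_continuous : continuous gap.
Proof.
move=> x; apply: cvgB; last exact: cvg_cst.
apply/cvgrPdist_le => e e0.
have /cvgrPdist_le/(_ e e0) := @continuous_clamp01 R x.
apply: filterS => y; apply: le_trans.
have /andP[cx0 cx1] := clamp01_itv x; have /andP[cy0 cy1] := clamp01_itv y.
have [xy|/ltW yx] := leP (clamp01 x) (clamp01 y).
  have /andP[lo hi] := flee_mass_lip cx0 xy cy1.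
  by rewrite distrC ger0_norm// distrC ger0_norm ?subr_ge0.
have /andP[lo hi] := flee_mass_lip cy0 yx cx1.
by rewrite ger0_norm// ger0_norm ?subr_ge0.
Qed.

(* [1 - sigma] averages at least [1/2] over [0, z] and less than [1/2] over
   [z, 1], so a fraction more than [z] of the fleeing types lies below [z]. *)
Lemma indifferent_lt_payoff z : {in `[0, 1] &, {homo sigma : x y / x < y}} ->
  0 < z -> z < 1 -> sigma z = 2^-1 ->
  flee_mass sigma z = B * flee_mass sigma 1 -> 0 < flee_mass sigma 1 -> z < B.
Proof.
move=> smono z0 z1 sz Fz F1.
have sle x y : 0 <= x -> x <= y -> y <= 1 -> sigma x <= sigma y.
  move=> x0; rewrite le_eqVlt => /predU1P[->//|xy y1]; apply/ltW/smono => //.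
  - by rewrite in_itv/= x0 (ltW (lt_le_trans xy y1)).
  - by rewrite in_itv/= y1 (ltW (le_lt_trans x0 xy)).
have bounds x y m M : 0 <= x -> x <= y -> y <= 1 ->
    (forall t, x <= t <= y -> m <= sigma t <= M) ->
    (1 - M) * (y - x) <= flee_mass sigma y - flee_mass sigma x
      <= (1 - m) * (y - x).
  move=> x0 xy y1 mM; apply: flee_mass_bounds => // t /mM/andP[mt tM].
  by rewrite !lerB.
(* The point [w] yields strictness: on [[w, 1]] the function [1 - sigma] is at most
   [1 - sigma w < 1/2]. *)
have [w zw w1] : exists2 w, z < w & w < 1.
  by exists ((z + 1) / 2); rewrite ?midf_lt.
have w0 := lt_trans z0 zw.
have sw : 2^-1 < sigma w.
  by rewrite -sz; apply: smono => //; rewrite in_itv/= !ltW.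
have /andP[a _] : (1 - 2^-1) * (z - 0) <= flee_mass sigma z - flee_mass sigma 0
    <= (1 - 0) * (z - 0).
  apply: bounds; rewrite ?(ltW z0) ?(ltW z1)// => t /andP[t0 tz].
  have /andP[-> _] : 0 <= sigma t <= 1.
    by apply: strategyP; rewrite // t0 (le_trans tz (ltW z1)).
  by rewrite -sz; apply: sle t0 tz (ltW z1).
have /andP[_ b] : (1 - 1) * (w - z) <= flee_mass sigma w - flee_mass sigma z
    <= (1 - 2^-1) * (w - z).
  apply: bounds; rewrite ?(ltW z0) ?(ltW zw) ?(ltW w1)// => t /andP[zt tw].
  have /andP[_ ->] : 0 <= sigma t <= 1.
    by apply: strategyP; rewrite // (le_trans (ltW z0) zt) (le_trans tw (ltW w1)).
  by rewrite andbT -sz; apply: sle (ltW z0) zt (le_trans tw (ltW w1)).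
have /andP[_ c] : (1 - 1) * (1 - w) <= flee_mass sigma 1 - flee_mass sigma w
    <= (1 - sigma w) * (1 - w).
  apply: bounds; rewrite ?(ltW w0) ?(ltW w1)// => t /andP[wt t1].
  have /andP[_ ->] : 0 <= sigma t <= 1.
    by apply: strategyP; rewrite // (le_trans (ltW w0) wt).
  by rewrite andbT; apply: sle (ltW w0) wt t1.
have {}c : flee_mass sigma 1 - flee_mass sigma w < 2^-1 * (1 - w).
  by apply: le_lt_trans c _; rewrite ltr_pM2r ?subr_gt0//; lra.
rewrite flee_mass0// !subr0 in a.
(* Writing [F] for [flee_mass sigma], [B <= z] would give [(1 - z) * F z <= z * (F 1 - F z) < z * (1
   - z) / 2], against [z / 2 <= F z]. *)
rewrite ltNge; apply/negP => Bz.
have fz1 : flee_mass sigma z <= z * flee_mass sigma 1 by rewrite Fz ler_pM2r.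
have : flee_mass sigma 1 - flee_mass sigma z < 2^-1 * (1 - z).
  by lra.
rewrite -(ltr_pM2l z0) => f1z.
have : (1 - 2^-1) * z * (1 - z) <= flee_mass sigma z * (1 - z).
  by rewrite ler_pM2r ?subr_gt0.
by lra.
Qed.

Hypothesis qsigma : qre (@mono_responsive R) B sigma.

Let response : exists2 q : R -> R, {homo q : x y / x < y} &
  [/\ forall x, 0 <= x <= 1 -> sigma x = q (gap x),
     forall t, 0 < q t < 1, continuous q & q 0 = 2^-1].
Proof.
have [Q mQ [sQ iQ cQ pQ]] := qre_gap qsigma; exists (fun t => Q (t, 0)).
  by move=> t u tu; have [] := mQ _ _ 0 tu.
split => // [x x01|].
  by rewrite gap_id//; apply: sQ; rewrite in_itv.
apply/eqP; rewrite eq_le; apply/andP; split.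
  by rewrite leNgt; apply/negP => /(pQ 0); rewrite ltxx.
(* If [Q (0, 0) < 1/2], continuity keeps the response below 1/2 at some positive gap [e / 2],
   contradicting payoff monotonicity. *)
rewrite leNgt; apply/negP => q0.
have /cvgr_lt/(_ _ q0) := cQ 0; move=> [e /= e0 eq].
have : Q (e / 2, 0) < 2^-1.
  apply: eq; rewrite /= sub0r normrN gtr0_norm ?divr_gt0//.
  by rewrite ltr_pdivrMr// ltr_pMr// ltr1n.
have /pQ : 0 < e / 2 by rewrite divr_gt0.
by move=> /lt_trans h /h; rewrite ltxx.
Qed.

Lemma qre_interior : interior_strategy sigma.
Proof.
have [q qinc [sq qitv qc q0]] := response.
by move=> x; rewrite in_itv/= => /sq ->.
Qed.

(** The gap never exceeds 1, so [sigma <= q 1 < 1] on [[0, 1]]. This bounds the slope of [gap] below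
    by [1 - q 1 > 0] before [sigma] is known to be monotone. *)
Let gap_inc x y : 0 <= x -> x < y -> y <= 1 -> gap x < gap y.
Proof.
have [q qinc [sq qitv qc q0]] := response.
move=> x0 xy y1.
have bound t : 0 <= t <= 1 -> gap t <= 1.
  move=> /[dup] t01 /andP[t0 t1]; rewrite /gap clamp01_id//.
  have /andP[_] := flee_mass_lip (lexx 0) t0 t1; rewrite flee_mass0// !subr0 => ft.
  have /andP[+ _] := flee_mass_lip (lexx 0) ler01 (lexx 1).
  rewrite flee_mass0// subr0 => f1.
  by have : 0 <= B * flee_mass sigma 1 by [exact: mulr_ge0 (ltW B_gt0) f1]; lra.
have sq1 t : 0 <= t <= 1 -> sigma t <= q 1.
  move=> t01; rewrite sq//; have := bound t t01.
  by rewrite le_eqVlt => /predU1P[->//|/qinc/ltW].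
rewrite /gap !clamp01_id ?x0 ?y1 ?(ltW (lt_le_trans xy y1)) ?(ltW (le_lt_trans x0 xy))//.
rewrite ltrD2r -subr_gt0.
have /andP[+ _] : (1 - q 1) * (y - x) <= flee_mass sigma y - flee_mass sigma x
    <= 1 * (y - x).
  apply: flee_mass_bounds => //; first exact: ltW.
  move=> t /andP[xt ty].
  have t01 : 0 <= t <= 1 by rewrite (le_trans x0 xt) (le_trans ty y1).
  have := sq1 t t01; have /andP[] := strategyP ssigma t01 => *.
  by apply/andP; split; lra.
apply: lt_le_trans; rewrite mulr_gt0 ?subr_gt0//.
by case/andP: (qitv 1).
Qed.

Lemma qre_continuous_increasing : continuous_increasing sigma.
Proof.
have [q qinc [sq qitv qc q0]] := response; split.
  apply: (@subspace_eq_continuous _ _ _ (q \o gap)).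
    by move=> x; rewrite inE/= in_itv/= => /sq.
  apply: continuous_subspaceT => x.
  by apply: continuous_comp; [exact: gap_continuous|exact: qc].
move=> x y; rewrite !in_itv/= => /[dup] x01 /andP[x0 _] /[dup] y01 /andP[_ y1] xy.
by rewrite !sq//; apply/qinc/gap_inc.
Qed.

Lemma qre_indifference : indifference_condition B sigma.
Proof.
have [q qinc [sq qitv qc q0]] := response.
have F1 : 0 < flee_mass sigma 1.
  have := gap_inc (lexx 0) ltr01 (lexx 1); rewrite /gap.
  by rewrite !clamp01_id ?lexx ?ler01// flee_mass0//; lra.
have g0 : gap 0 < 0.
  by rewrite /gap clamp01_id ?lexx ?ler01// flee_mass0// sub0r oppr_lt0 mulr_gt0.
have g1 : 0 < gap 1.
  rewrite /gap clamp01_id ?lexx ?ler01//.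
  have -> : flee_mass sigma 1 - B * flee_mass sigma 1 = (1 - B) * flee_mass sigma 1.
    by ring.
  by rewrite mulr_gt0// subr_gt0.
have [|||z z01 gz] := @IVT _ gap 0 1 0.
- exact: ler01.
- exact: continuous_subspaceT gap_continuous.
- by rewrite min_l ?max_r; [rewrite !ltW|lra|lra].
rewrite in_itv/= in z01; case/andP: (z01) => z0 z1.
have {}z0 : 0 < z.
  rewrite lt_neqAle z0 andbT; apply/eqP => zE.
  by move: g0; rewrite [X in gap X]zE gz ltxx.
have {}z1 : z < 1.
  rewrite lt_neqAle z1 andbT; apply/eqP => zE.
  by move: g1; rewrite -[X in gap X]zE gz ltxx.
have sz : sigma z = 2^-1 by rewrite sq// gz.
have Fz : flee_mass sigma z = B * flee_mass sigma 1.
  by move: gz; rewrite /gap clamp01_id// => /eqP; rewrite subr_eq0 => /eqP.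
have gap_inj x y : 0 <= x <= 1 -> 0 <= y <= 1 -> gap x = gap y -> x = y.
  move=> /andP[x0 x1] /andP[y0 y1] gxy.
  have [xy|yx|//] := ltgtP x y.
    by have := gap_inc x0 xy y1; rewrite gxy ltxx.
  by have := gap_inc y0 yx x1; rewrite gxy ltxx.
exists z; split; first split.
- by split; [rewrite in_itv/= z01|rewrite -gap_id].
- move=> y [y01 gy]; rewrite in_itv/= in y01; apply: gap_inj => //.
  by rewrite gz gap_id.
have smono := qre_continuous_increasing.2.
have zB := indifferent_lt_payoff smono z0 z1 sz Fz F1.
(* Injectivity makes [flee_quantile] a genuine left inverse on [[0, 1]], so its default value does
   not interfere. *)
have cdf_inj : {in `[0, 1]%classic &, injective (flee_cdf sigma)}.
  move=> x y; rewrite !inE/= !in_itv/= => x01 y01.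
  rewrite /flee_cdf -!/(flee_mass sigma _) => /(mulIf _) fxy.
  apply: gap_inj => //; rewrite /gap !clamp01_id// fxy//.
  by rewrite invr_eq0 gt_eqF.
have cdfz : flee_cdf sigma z = B.
  by rewrite /flee_cdf -!/(flee_mass sigma _) Fz mulfK// gt_eqF.
have -> : flee_quantile sigma B = z.
  by rewrite -cdfz /flee_quantile pinvKV// inE/= in_itv/= z01.
by split=> //; rewrite in_itv/= z0.
Qed.

(** On [[0, 1]], [sigma] is the response composed with [gap_ext]; by the chain rule its slope is the
    derivative of the response times [1 - sigma x > 0]. *)
Lemma qre_positive_derivative :
  qre (@diff_responsive R) B sigma -> positive_derivative sigma.
Proof.
move=> /qre_gap[Q dQ [sQ iQ cQ pQ]] x xin; have x01 := xin; rewrite in_itv/= in x01.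
have [d _ p _] := dQ (payoff_gap B sigma x, 0); rewrite /= in d p.
have csigma := qre_continuous_increasing; have isigma := qre_interior.
have dg := @gap_ext_is_derive _ _ B ssigma csigma isigma x.
have gx := gap_ext_id B ssigma x01.
have dq : is_derive (gap_ext sigma B x) 1 (fun t => Q (t, 0))
    (derive1 (fun t => Q (t, 0)) (gap_ext sigma B x)).
  by rewrite derive1E; apply: derivableP; rewrite gx.
have := @is_derive1_comp _ (fun t => Q (t, 0)) (gap_ext sigma B) x _ _ dq dg.
rewrite clamp01_id// gx => /has_slope_is_derive sl.
exists (derive1 (fun t => Q (t, 0)) (payoff_gap B sigma x) * (1 - sigma x)).
  by rewrite mulr_gt0// subr_gt0; case/andP: (isigma _ xin).
apply/has_slope_cvg; apply: eq_has_slope; last first.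
- exact: has_slopeS (@subsetT _ _) sl.
- move=> y; rewrite inE/= => yin; rewrite sQ//= gap_ext_id//.
- exact: xin.
Qed.

End necessity.

(** * Existence of equilibria with a given indifferent type *)

Section existence.
Context {R : realType}.
Variables (B z : R).
Implicit Types x y : R.
Hypotheses (B_lt1 : B < 1) (z_gt0 : 0 < z) (zB : z < B).

(** The steepness of the logistic curve, large enough that [ln 2 / k < (1 - B) * z]. *)
Let k : R := 2 / ((1 - B) * z).

Let k_gt0 : 0 < k.
Proof. by rewrite divr_gt0 ?mulr_gt0 ?subr_gt0. Qed.

Let E x := expR (k * (x - z)).

Let E_gt0 x : 0 < E x. Proof. exact: expR_gt0. Qed.

Let oneE_gt0 x : 0 < 1 + E x. Proof. by rewrite addr_gt0. Qed.

Let E_inc x y : x < y -> E x < E y.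
Proof. by move=> xy; rewrite ltr_expR ltr_pM2l// ltrD2r. Qed.

Let E_is_derive x : is_derive x 1 E (E x * k).
Proof.
have dl : is_derive x 1 (fun y : R => k * (y - z)) k.
  by apply: is_derive_eq; rewrite /GRing.scale/=; ring.
by apply: (@is_derive1_comp _ expR _ x _ _ _ dl); exact: is_derive_expR.
Qed.

(** An antiderivative of the logistic fleeing probability [(1 + E x)^-1]. *)
Let P x := x - ln (1 + E x) / k.

Let P_is_derive x : is_derive x 1 P (1 + E x)^-1.
Proof.
have dE := E_is_derive x.
have d1E : is_derive x 1 (fun y => 1 + E y) (E x * k).
  by rewrite -[E x * k]add0r; exact: (is_deriveD (is_derive_cst (1 : R) x 1) dE).
have dln : is_derive x 1 (fun y => ln (1 + E y)) ((1 + E x)^-1 * (E x * k)).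
  by apply: (@is_derive1_comp _ (@ln R) (fun y => 1 + E y) x _ _ _ d1E);
    exact: is_derive1_ln.
have -> : P = id - k^-1 *: (fun y => ln (1 + E y)).
  by apply/funext => y; rewrite /P [_ / k]mulrC.
apply: is_derive_eq; rewrite /GRing.scale/=; field.
by rewrite !gt_eqF.
Qed.

Let a := P z - P 0.
Let b := P 1 - P z.

(** The expression equals [P z - (1 - B) * P 0 - B * P 1], where [P 0 <= 0], [P 1 <= z] and, by the
    choice of [k], [P z > B * z]. *)
Let ab : 0 < (1 - B) * a - B * b.
Proof.
have l0 : 0 <= ln (1 + E 0) / k.
  by rewrite divr_ge0 ?(ltW k_gt0)// ln_ge0// lerDl ltW.
have l1 : 1 - z <= ln (1 + E 1) / k.
  rewrite ler_pdivlMr// mulrC -ler_expR lnK ?posrE//.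
  by rewrite -/(E 1) lerDr.
have lz : ln (1 + E z) / k < (1 - B) * z.
  rewrite /E subrr mulr0 expR0 ltr_pdivrMr//.
  apply: (@le_lt_trans _ _ 1); first exact: le_ln1Dx.
  have Bz : (1 - B) * z != 0 by rewrite gt_eqF// mulr_gt0// subr_gt0.
  by rewrite /k mulrC divfK// ltr1n.
have B0 : 0 <= B by rewrite ltW// (lt_trans z_gt0).
have Bl0 : 0 <= (1 - B) * (ln (1 + E 0) / k).
  by rewrite mulr_ge0// subr_ge0 ltW.
have Bl1 : 0 <= B * (ln (1 + E 1) / k - (1 - z)) by rewrite mulr_ge0// subr_ge0.
rewrite /a /b /P; move: Bl0 Bl1 lz.
by move: (ln (1 + E 0) / k) (ln (1 + E 1) / k) (ln (1 + E z) / k) => p q r; lra.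
Qed.

(* The indifference equation at [z] is affine in the strategy. It fails with
   opposite signs for the constant [1 / 2] and for the logistic strategy; [lam]
   is the weight of the latter for which it holds. *)
Let lam := ((B - z) / 2) / ((B - z) / 2 + ((1 - B) * a - B * b)).

Let lam_itv : 0 < lam < 1.
Proof.
have Bz : 0 < (B - z) / 2 by rewrite divr_gt0 ?subr_gt0.
have den : 0 < (B - z) / 2 + ((1 - B) * a - B * b) by exact: addr_gt0.
by rewrite /lam divr_gt0//= ltr_pdivrMr// mul1r ltrDl.
Qed.

Let sigma x := 1 - ((1 - lam) / 2 + lam * (1 + E x)^-1).

Let G x := (1 - lam) / 2 * x + lam * P x.

(** As [G] is an antiderivative of [1 - sigma], this is indifference at [z]. It amounts to [(1 -
    lam) * (z - B) / 2 + lam * ((1 - B) * a - B * b) = 0], which [lam] solves. *)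
Let G_balanced : G z - G 0 = B * (G 1 - G 0).
Proof.
have Bz : 0 < (B - z) / 2 by rewrite divr_gt0 ?subr_gt0.
have den : (B - z) / 2 + ((1 - B) * a - B * b) != 0.
  by rewrite gt_eqF//; exact: addr_gt0.
have : lam * ((B - z) / 2 + ((1 - B) * a - B * b)) = (B - z) / 2.
  by rewrite /lam divfK.
by rewrite /G /a /b; move: (P z) (P 0) (P 1) => p q r; lra.
Qed.

Let sigma_interior x : 0 < sigma x < 1.
Proof.
case/andP: lam_itv => l0 l1.
have p0 : 0 < (1 + E x)^-1 by rewrite invr_gt0.
have p1 : (1 + E x)^-1 < 1 by rewrite invf_lt1// ltrDl.
have lp0 : 0 < lam * (1 + E x)^-1 by exact: mulr_gt0.
have lp1 : lam * (1 + E x)^-1 < lam by rewrite gtr_pMr.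
by rewrite /sigma; apply/andP; split; lra.
Qed.

Let sigma_is_derive x :
  is_derive x 1 sigma (lam * k * E x / (1 + E x) ^+ 2).
Proof.
have dE := E_is_derive x.
have d1E : is_derive x 1 (fun y => 1 + E y) (E x * k).
  by rewrite -[E x * k]add0r; exact: (is_deriveD (is_derive_cst (1 : R) x 1) dE).
have nz : 1 + E x != 0 by rewrite gt_eqF.
have dV := @is_deriveV _ (fun y => 1 + E y) x _ 1 nz d1E.
have -> : sigma = cst (1 - (1 - lam) / 2) - lam *: (fun y => (1 + E y)^-1).
  by apply/funext => y; rewrite /sigma opprD addrA.
apply: is_derive_eq; rewrite /GRing.scale/=; field.
exact: nz.
Qed.

Let sigma_continuous : continuous sigma.
Proof.
move=> x; have [dx _] := sigma_is_derive x.
exact/differentiable_continuous/derivable1_diffP.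
Qed.

Let sigma_strategy : strategy sigma.
Proof.
split; last by move=> x _; case/andP: (sigma_interior x) => ? ?; rewrite !ltW.
apply: measurable_fun_lebesgueR; first exact: measurable_itv.
by apply: measurable_funTS; exact: measurable_realfun.continuous_measurable_fun.
Qed.

Let sigma_increasing : continuous_increasing sigma.
Proof.
split; first exact: continuous_subspaceT.
move=> x y _ _ xy; case/andP: lam_itv => l0 _.
rewrite /sigma ltrD2l ltrN2 ltrD2l ltr_pM2l// ltf_pV2 ?posrE//.
by rewrite ltrD2l E_inc.
Qed.

Let sigma_positive_derivative : positive_derivative sigma.
Proof.
move=> x _; exists (lam * k * E x / (1 + E x) ^+ 2).
  case/andP: lam_itv => l0 _; apply: divr_gt0; last exact: exprn_gt0.
  by apply: mulr_gt0; [exact: mulr_gt0|exact: E_gt0].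
apply/has_slope_cvg; apply: (@has_slopeS _ _ setT) => //.
by apply/has_slope_is_derive; exact: sigma_is_derive.
Qed.

Let flee_mass_sigma x : 0 <= x <= 1 -> flee_mass sigma x = G x - G 0.
Proof.
move=> x01; case/andP: (x01) => x0 x1.
have isigma : interior_strategy sigma by move=> y _; exact: sigma_interior.
(* With compromise payoff 0, [gap_ext] is the fleeing mass itself on [[0, 1]]; [D] has zero
   derivative there, so the mean value theorem makes it constant. *)
pose D := gap_ext sigma 0 - G.
have dD y : is_derive y 1 D
    (1 - sigma (clamp01 y) - ((1 - lam) / 2 + lam * (1 + E y)^-1)).
  have dg := @gap_ext_is_derive _ _ 0 sigma_strategy sigma_increasing isigma y.
  have dP := P_is_derive y.
  have dG : is_derive y 1 G ((1 - lam) / 2 + lam * (1 + E y)^-1).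
    have dG := is_deriveD (is_deriveZ ((1 - lam) / 2) (is_derive_id y 1))
      (is_deriveZ lam dP).
    by rewrite -[X in X + _]mulr1; exact: dG.
  by rewrite /D; apply: is_derive_eq.
have [|y] := @MVT_segment _ D (fun y => 1 - sigma (clamp01 y) -
    ((1 - lam) / 2 + lam * (1 + E y)^-1)) 0 x x0.
  apply: continuous_subspaceT => y; have [dy _] := dD y.
  exact/differentiable_continuous/derivable1_diffP.
rewrite in_itv/= => /andP[y0 yx].
rewrite clamp01_id; last by rewrite y0 (le_trans yx x1).
have DE u : D u = gap_ext sigma 0 u - G u by [].
rewrite [X in 1 - X]/sigma subKr subrr mul0r !DE => /eqP; rewrite subr_eq0 => /eqP.
rewrite !gap_ext_id ?lexx ?ler01// !payoff_gapE ?lexx ?ler01//.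
rewrite flee_mass0// !mul0r subr0 sub0r => /(canRL (subrK _)) ->.
by rewrite oppr0 add0r addrC.
Qed.

Lemma strategy_with_indifferent_type :
  exists2 s : R -> R, strategy s & [/\ continuous_increasing s,
    interior_strategy s, positive_derivative s, indifferent B s z & s z = 2^-1].
Proof.
have z01 : 0 <= z <= 1 by rewrite !ltW// (lt_trans zB).
exists sigma; [exact: sigma_strategy|split].
- exact: sigma_increasing.
- by move=> x _; exact: sigma_interior.
- exact: sigma_positive_derivative.
- split; first by rewrite in_itv/= z01.
  rewrite payoff_gapE// !flee_mass_sigma ?lexx ?ler01// G_balanced.
  by rewrite subrr.
(* [E z = 1], so both strategies in the mixture take the value 1/2 at [z]. *)
- by rewrite /sigma /E subrr mulr0 expR0; field.
Qed.

End existence.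

(** * Assembly for both forms of responsiveness *)

Theorem proposition7 (R : realType) (B : R) (hB0 : 0 < B) (hB : B <= 2^-1) :
  (indifferent_types (@mono_responsive R) B = (`]0, B[)%classic /\
   forall sigma : R -> R, strategy sigma ->
     (qre (@mono_responsive R) B sigma <->
      [/\ continuous_increasing sigma, interior_strategy sigma
        & indifference_condition B sigma]))
  /\
  (indifferent_types (@diff_responsive R) B = (`]0, B[)%classic /\
   forall sigma : R -> R, strategy sigma ->
     (qre (@diff_responsive R) B sigma <->
      [/\ continuous_increasing sigma, interior_strategy sigma,
          indifference_condition B sigma & positive_derivative sigma])).
Proof.
have B1 : B < 1 by apply: le_lt_trans hB _; rewrite invf_lt1// ltr1n.
have witness s : indifference_condition B s ->
    exists2 x, indifferent B s x & s x = 2^-1.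
  by move=> [x [[ix _] [_ sx _]]]; exists x.
have types s x : strategy s -> qre (@mono_responsive R) B s ->
    indifferent B s x -> `]0, B[%classic x.
  move=> ss qs ix.
  by have [y [[_ uy] [yB _ _]]] := qre_indifference hB0 B1 ss qs; rewrite -(uy x ix).
(* The differentiable equilibrium built here realizes [x] for the ordinal form as well, through
   [qre_diff_mono]. *)
have gen x : `]0, B[%classic x -> exists2 s, strategy s &
    qre (@diff_responsive R) B s /\ indifferent B s x.
  rewrite /= in_itv/= => /andP[x0 xB].
  have [s ss [cs is_ ds ix sx]] := strategy_with_indifferent_type B1 x0 xB.
  by exists s => //; split => //; apply: characterization_diff => //; exists x.
split; split.
- apply/seteqP; split => x; first by move=> [s [ss qs]]; exact: types ss qs.
  by move=> /gen[s ss [/qre_diff_mono qs ix]]; exists s.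
- move=> s ss; split => [qs|[cs is_ /witness ws]].
    split; [exact: qre_continuous_increasing qs|exact: qre_interior qs|].
    exact: qre_indifference.
  exact: characterization_mono.
- apply/seteqP; split => x; last by move=> /gen[s ss [qs ix]]; exists s.
  by move=> [s [ss /qre_diff_mono qs]]; exact: types ss qs.
- move=> s ss; split => [qd|[cs is_ /witness ws ds]].
    have qs := qre_diff_mono qd.
    split; [exact: qre_continuous_increasing qs|exact: qre_interior qs| |].
      exact: qre_indifference.
    exact: qre_positive_derivative qd.
  exact: characterization_diff.
Qed.
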